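(* Let $b\ge 2$ and let $n_1,\ldots,n_b$ be positive integers. Let $\Delta$ be the squared distance matrix of the starlike block graph $\mathcal{S}(n_1,n_2,\ldots,n_b)$ and let $\Delta_{22}$ be the principal submatrix of $\Delta$ obtained by deleting the row and column corresponding to the central cut vertex. Then the characteristic polynomials of $\Delta$ and $\Delta_{22}$ are $$P_{\Delta}(x)=(x+1)^{\sum_{i=1}^{b}n_i-b}\left(x\prod_{i=1}^{b}(x+3n_i+1)-(4x+1)\sum_{i=1}^b n_i\prod_{j\ne i}(x+3n_j+1)\right)$$ and $$P_{\Delta_{22}}(x)=(x+1)^{\sum_{i=1}^{b}n_i-b}\left(\prod_{i=1}^{b}(x+3n_i+1)-4\sum_{i=1}^{b}n_i\prod_{j\ne i}(x+3n_j+1)\right).$$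
   Context: The starlike block graph $\mathcal{S}(n_1,\ldots,n_b)$ is the graph consisting of $b\ge 2$ blocks which are the complete graphs $K_{n_1+1},\ldots,K_{n_b+1}$ (each $n_i\ge 1$), all sharing exactly one common vertex, the central cut vertex. It has $n=1+\sum_{i=1}^b n_i$ vertices. For a simple connected graph $G$ with vertices $v_1,\ldots,v_n$, the squared distance matrix is $\Delta(G)=[d(v_i,v_j)^2]$, where $d$ is the shortest-path distance. The characteristic polynomial of a square matrix $A$ is $P_A(x)=\det(xI-A)$. In $\prod_{j\neq i}$ the index $j$ runs over $\{1,\ldots,b\}\setminus\{i\}$. *)

(* Defs.v *)
From HB Require Import structures.
From mathcomp Require Import all_boot all_order all_algebra.

Set Implicit Arguments.
Unset Strict Implicit.
Unset Printing Implicit Defensive.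

Import GRing.Theory.
Local Open Scope ring_scope.

(* [path e x p] is a walk with [size p] edges starting at [x], so this is the
   least number of edges of a walk from x to y.  A shortest walk has fewer than
   #|T| edges; the value #|T| is returned when y is not reachable from x. *)
Definition gdist (T : finType) (e : rel T) (x y : T) : nat :=
  find (fun k => [exists p : k.-tuple T, path e x p && (last x p == y)])
       (iota 0 #|T|).

(* The rows and columns are indexed by the vertices via [enum_rank]. *)
Definition sqdist_mx (R : nzRingType) (T : finType) (e : rel T) : 'M[R]_#|T| :=
  \matrix_(i, j) (gdist e (enum_val i) (enum_val j) ^ 2)%N%:R.

(* [None] is the central cut vertex; [Some (Tagged _ k)] with k : 'I_(n i) is
   one of the n i remaining vertices of the i-th block. *)
Definition slb_vertex (b : nat) (n : 'I_b -> nat) : finType :=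
  option {i : 'I_b & 'I_(n i)}.

Definition slb_block (b : nat) (n : 'I_b -> nat) (i : 'I_b) :
    {set slb_vertex n} :=
  [set v | if v is Some w then tag w == i else true].

(* Each block induces a complete graph, and there are no other edges. *)
Definition slb_adj (b : nat) (n : 'I_b -> nat) : rel (slb_vertex n) :=
  fun u v => (u != v) &&
    [exists i, (u \in slb_block n i) && (v \in slb_block n i)].

Definition slb_Delta (R : nzRingType) (b : nat) (n : 'I_b -> nat) :
    'M[R]_#|slb_vertex n| :=
  sqdist_mx R (@slb_adj b n).

Definition slb_center (b : nat) (n : 'I_b -> nat) : slb_vertex n := None.

Definition slb_Delta22 (R : nzRingType) (b : nat) (n : 'I_b -> nat) :
    'M[R]_#|slb_vertex n|.-1 :=
  let c := enum_rank (slb_center n) in row' c (col' c (slb_Delta R n)).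

Lemma gdistP (T : finType) (e : rel T) (x y : T) : connect e x y ->
  (exists p, [/\ path e x p, last x p = y & size p = gdist e x y]) /\
  (forall p, path e x p -> last x p = y -> (gdist e x y <= size p)%N).
Proof.
rewrite /gdist; set a : pred nat := fun k : nat => [exists p : k.-tuple T, _].
have aP p : path e x p -> last x p = y -> a (size p).
  by move=> h1 h2; apply/existsP; exists (in_tuple p); rewrite /= h1 h2 eqxx.
have le q : path e x q -> last x q = y -> (find a (iota 0 #|T|) <= size q)%N.
  move=> q1 q2; rewrite leqNgt; apply/negP=> lt.
  have sz : (size q < #|T|)%N.
    by apply: leq_trans lt _; rewrite (leq_trans (find_size _ _)) ?size_iota.
  by have := before_find 0%N lt; rewrite nth_iota // add0n aP.
move=> /connectP[p0 p0P yE]; split=> //.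
case/shortenP: p0P yE => p pP pU _ yE.
have sz : (size p < #|T|)%N by have /card_uniqP/= <- := pU; apply: max_card.
have hasa : has a (iota 0 #|T|).
  by apply/hasP; exists (size p); [rewrite mem_iota | apply: aP].
have := nth_find 0%N hasa; rewrite nth_iota; last by rewrite -{2}(size_iota 0 #|T|) -has_find.
rewrite add0n => /existsP[q /andP[q1 /eqP q2]].
by exists q; rewrite size_tuple.
Qed.

Lemma slb_adj_sym (b : nat) (n : 'I_b -> nat) : symmetric (@slb_adj b n).
Proof.
move=> u v; rewrite /slb_adj eq_sym; congr andb.
by apply: eq_existsb => i; rewrite andbC.
Qed.

Lemma slb_adj_irr (b : nat) (n : 'I_b -> nat) : irreflexive (@slb_adj b n).
Proof. by move=> u; rewrite /slb_adj eqxx. Qed.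

Lemma slb_connected (b : nat) (n : 'I_b -> nat) (u v : slb_vertex n) :
  connect (@slb_adj b n) u v.
Proof.
have ctr (w : slb_vertex n) : connect (@slb_adj b n) w None.
  case: w => [w|]; last exact: connect0.
  by apply/connect1/existsP; exists (tag w); rewrite !inE eqxx.
by apply: connect_trans (ctr u) _; rewrite (sym_connect_sym (@slb_adj_sym b n)).
Qed.

Lemma card_slb_vertex (b : nat) (n : 'I_b -> nat) :
  #|slb_vertex n| = (1 + \sum_(i < b) n i)%N.
Proof.
by rewrite card_option card_tagged sumnE big_map big_enum add1n; congr S;
  apply: eq_bigr => i _; rewrite card_ord.
Qed.

Lemma card_slb_block (b : nat) (n : 'I_b -> nat) (i : 'I_b) :
  #|slb_block n i| = (n i).+1.
Proof.
have -> : slb_block n i =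
    None |: [set Some (Tagged (fun j => 'I_(n j)) k) | k : 'I_(n i)].
  apply/setP=> -[[j k]|]; rewrite !inE //=.
  apply/eqP/imsetP => [ji|[k' _ /(congr1 (omap tag)) [->]] //].
  by subst j; exists k.
rewrite cardsU1 card_imset ?card_ord; last first.
  by move=> k k' [] /eqP; rewrite -tag_eqE /tag_eq /= eqxx tagged_asE => /eqP.
rewrite (_ : None \notin _) ?add1n //.
by apply/imsetP=> -[].
Qed.

(* Main.v *)
Require Import Defs.
From HB Require Import structures.
From mathcomp Require Import all_boot all_order all_algebra.
From mathcomp Require Import ring.

(** Two distinct vertices lie at squared distance 1 when some block contains
    both, and at squared distance 4 (through the central vertex) otherwise.
    Since 0 = 1 - 1, adding the identity to the squared distance matrix makes
    its diagonal follow the first rule as well: the (u, v) entry of Delta + I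
    is 4 or 1 and depends only on the blocks of u and v ([slb_sqdist]).  Put
    y = x + 1.  Then xI - Delta = yI + E K E^T, where E is the 0/1 incidence
    matrix between the vertices and the classes of interchangeable vertices,
    and K has entries -1 and -4.  The identity
      y^k det(yI + U V) = y^m det(yI + V U)
    ([det_scalar_addMC]) trades this determinant, whose size is the number of
    vertices, for that of yI + K D, whose size is the number of classes, where
    D = E^T E is the diagonal matrix of class sizes
    ([det_scalar_add_const_blocks]).  This accounts for the power of x + 1.

    With the central vertex deleted, the classes are the b blocks, and
    yI + K D is the diagonal matrix of the x + 3 n_i + 1 plus a matrix of rank
    one.  For the whole graph the central vertex is a class by itself;
    subtracting 4 times its row from the others removes the rank one part and
    leaves an arrowhead matrix.  Both determinants thus come from the
    arrowhead formula ([det_arrowhead], [det_arrowhead_row_op]); the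
    arrow has corner 1 and column entries 4 in the first case, corner x and
    column entries -(4x + 1) in the second. *)

Set Implicit Arguments.
Unset Strict Implicit.
Import GRing.Theory.
Local Open Scope ring_scope.

(** * Determinants of low-rank and arrowhead matrices *)

(** The two sides come from clearing one or the other off-diagonal block of
    [[y, -U], [V, 1]] by column operations; multiplying by y rather than
    dividing by it keeps the argument valid over any commutative ring. *)
Lemma det_scalar_addMC (R : comNzRingType) m k (y : R)
    (U : 'M[R]_(m, k)) (V : 'M[R]_(k, m)) :
  y ^+ k * \det (y%:M + U *m V) = y ^+ m * \det (y%:M + V *m U).
Proof.
pose M := block_mx (y%:M : 'M_m) (- U) V (1%:M : 'M_k).
have detM : \det M = \det (y%:M + U *m V).
  have E : M *m block_mx 1%:M 0 (- V) 1%:M = block_mx (y%:M + U *m V) (- U) 0 1%:M.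
    rewrite /M mulmx_block !mulmx1 !mul1mx !mulmx0 !add0r mulNmx mulmxN opprK.
    by rewrite subrr.
  have := congr1 determinant E.
  by rewrite det_mulmx det_lblock det_ublock !det1 !mulr1.
have E : M *m block_mx 1%:M U 0 y%:M = block_mx y%:M 0 V (y%:M + V *m U).
  rewrite /M mulmx_block !mulmx1 !mul1mx !mulmx0 !addr0 mulNmx.
  by rewrite mul_scalar_mx mul_mx_scalar subrr [V *m U + _]addrC.
have := congr1 determinant E.
by rewrite det_mulmx det_ublock det_lblock !det_scalar expr1n mul1r detM mulrC.
Qed.

(** A matrix whose entries depend only on the classes [t i] and [t j] factors
    through the incidence matrix E of [t], and E^T E is the diagonal matrix of
    the class sizes. *)
Lemma det_scalar_add_const_blocks (R : comNzRingType) m k (y : R)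
    (t : 'I_m -> 'I_k) (K : 'M[R]_k) :
  y ^+ k * \det (y%:M + \matrix_(i, j) K (t i) (t j)) =
  y ^+ m * \det (y%:M + K *m diag_mx (\row_c #|[set i | t i == c]|%:R)).
Proof.
pose E : 'M[R]_(m, k) := \matrix_(i, c) (t i == c)%:R.
have -> : \matrix_(i, j) K (t i) (t j) = E *m (K *m E^T).
  apply/matrixP => i j; rewrite !mxE (bigD1 (t i)) //= !mxE eqxx mul1r.
  rewrite (bigD1 (t j)) //= !mxE eqxx mulr1 !big1 ?addr0 // => c /negPf ne.
    by rewrite !mxE eq_sym ne mul0r.
  by rewrite !mxE eq_sym ne mulr0.
rewrite det_scalar_addMC -mulmxA; congr (_ * \det (_ + _ *m _)).
apply/matrixP => c d; rewrite !mxE -sum1dep_card natr_sum.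
rewrite -sumrMnl [RHS]big_mkcond; apply: eq_bigr => i _; rewrite !mxE.
by case: eqP => [->|_]; rewrite ?mul0r // mul1r.
Qed.

(** Adding suitable multiples of the last columns to P times the first one,
    where P is the product of the [d 0 i], clears the lower left block; the
    determinant then appears multiplied by P, which is cancelled. *)
Lemma det_arrowhead (R : idomainType) k (a : R)
    (v : 'rV[R]_k) (u : 'cV[R]_k) (d : 'rV[R]_k) :
  \prod_i d 0 i != 0 ->
  \det (block_mx a%:M v u (diag_mx d)) =
  a * \prod_i d 0 i - \sum_i v 0 i * u i 0 * \prod_(j | j != i) d 0 j.
Proof.
set P := \prod_i d 0 i => P0.
pose c := \col_i (u i 0 * \prod_(j | j != i) d 0 j).
have E : block_mx a%:M v u (diag_mx d) *m block_mx P%:M 0 (- c) 1%:M =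
         block_mx (a%:M *m P%:M - v *m c) v 0 (diag_mx d).
  rewrite mulmx_block !mulmx1 !mulmx0 !add0r !mulmxN.
  congr (block_mx _ _ _ _); apply/matrixP => i j.
  rewrite !mul_diag_mx mul_mx_scalar !mxE !ord1 /P (bigD1 i) //=; ring.
have := congr1 determinant E.
rewrite det_mulmx det_lblock det_ublock det1 mulr1 det_scalar expr1.
rewrite det_diag -/P => /(mulIf P0) ->.
rewrite det_mx11 -scalar_mxM !mxE eqxx mulr1n; congr (_ - _).
by apply: eq_bigr => i _; rewrite !mxE mulrA.
Qed.

(** Adding [w i 0] times the first row to the [i]-th row below it turns an
    arrowhead matrix into this one. *)
Lemma det_arrowhead_row_op (R : idomainType) k (a : R)
    (v : 'rV[R]_k) (u w : 'cV[R]_k) (d : 'rV[R]_k) :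
  \prod_i d 0 i != 0 ->
  \det (block_mx a%:M v (u + a *: w) (diag_mx d + w *m v)) =
  a * \prod_i d 0 i - \sum_i v 0 i * u i 0 * \prod_(j | j != i) d 0 j.
Proof.
move=> /det_arrowhead <-.
have <- : block_mx 1%:M 0 w 1%:M *m block_mx a%:M v u (diag_mx d) =
         block_mx a%:M v (u + a *: w) (diag_mx d + w *m v).
  rewrite mulmx_block !mul1mx !mul0mx !addr0 mul_mx_scalar.
  by rewrite [_ + u]addrC [_ + diag_mx d]addrC.
by rewrite det_mulmx det_lblock !det1 !mul1r.
Qed.

(** The case where the row operation leaves a unit first column. *)
Lemma det_diag_add_rank1 (R : idomainType) k
    (v : 'rV[R]_k) (w : 'cV[R]_k) (d : 'rV[R]_k) :
  \prod_i d 0 i != 0 ->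
  \det (diag_mx d + w *m v) =
  \prod_i d 0 i + \sum_i v 0 i * w i 0 * \prod_(j | j != i) d 0 j.
Proof.
move=> /(det_arrowhead_row_op 1 v (- w) w).
rewrite scale1r addNr det_ublock det1 !mul1r => ->.
rewrite -sumrN; congr (_ + _); apply: eq_bigr => i _.
by rewrite !mxE mulrN mulNr opprK.
Qed.

(** * Distances in the starlike block graph *)

(** The central vertex belongs to every block, so that it is never separated
    from another vertex. *)
Definition split_blocks (b : nat) (n : 'I_b -> nat) (u v : slb_vertex n) : bool :=
  match u, v with Some w, Some w' => tag w != tag w' | _, _ => false end.

Lemma slb_adjE (b : nat) (n : 'I_b -> nat) (u v : slb_vertex n) :
  slb_adj u v = (u != v) && ~~ split_blocks u v.
Proof.
rewrite /slb_adj; case: u v => [w|] [w'|] //; congr andb => /=.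
- rewrite negbK; apply/existsP/eqP => [[i]|e].
    by rewrite !inE => /andP[/eqP wi /eqP w'i]; rewrite wi w'i.
  by exists (tag w); rewrite !inE e eqxx.
- by apply/existsP; exists (tag w); rewrite !inE eqxx.
- by apply/existsP; exists (tag w'); rewrite !inE eqxx.
Qed.

Lemma split_blocks_refl (b : nat) (n : 'I_b -> nat) (u : slb_vertex n) :
  split_blocks u u = false.
Proof. by case: u => //= w; rewrite eqxx. Qed.

(** The summand [u == v] turns the zero diagonal into ones, so that the result
    depends on the blocks of [u] and [v] only. *)
Lemma slb_sqdist (b : nat) (n : 'I_b -> nat) (u v : slb_vertex n) :
  (gdist (@slb_adj b n) u v ^ 2 + (u == v) =
   if split_blocks u v then 4 else 1)%N.
Proof.
have [[p [pP pl <-]] le] := gdistP (slb_connected u v).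
have [uv|ne] := eqVneq u v.
  have := le [::] isT uv.
  by rewrite leqn0 uv split_blocks_refl => /eqP ->.
case: ifP => sb; last first.
  have : (size p <= 1)%N by apply: (le [:: v]); rewrite //= slb_adjE ne sb.
  by case: p pl {pP le} => [|x []] //= uv; rewrite uv eqxx in ne.
have : (size p <= 2)%N.
  apply: (le [:: None; v]); rewrite //= !slb_adjE.
  by case: u v sb {pl le pP ne} => [w|] [w'|].
case: p pP pl {le} => [|x [|y []]] //=.
  by move=> _ uv; rewrite uv eqxx in ne.
by move=> + xv; rewrite xv slb_adjE sb andbF.
Qed.

(** * Reduction to one row per block *)

(** An arbitrary injective labelling [f] of some vertices lets the same lemma
    serve for the whole matrix and for the one without the central vertex. *)
Lemma char_poly_slb_vertices (R : comNzRingType) (b : nat) (n : 'I_b -> nat) m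
    (f : 'I_m -> slb_vertex n) : injective f ->
  char_poly (\matrix_(i, j) (gdist (@slb_adj b n) (f i) (f j) ^ 2)%:R : 'M[R]_m) =
  \det (('X + 1)%:M +
        \matrix_(i, j) (if split_blocks (f i) (f j) then - 4%:R else - 1)).
Proof.
move=> f_inj; congr determinant; apply/matrixP => i j; rewrite !mxE.
rewrite rmorph_nat mulrnDl -addrA; congr (_ + _).
rewrite -(inj_eq f_inj).
have := congr1 (fun k => k%:R : {poly R}) (slb_sqdist (f i) (f j)).
rewrite natrD; move: (_ ^ 2)%N => k /(canRL (addrK _)) ->.
by case: ifP => _; rewrite opprB.
Qed.

Lemma card_tag_fibre (b : nat) (n : 'I_b -> nat) (c : 'I_b) :
  #|[set x : {i : 'I_b & 'I_(n i)} | tag x == c]| = n c.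
Proof.
have -> : [set x | tag x == c] = [set Tagged (fun i => 'I_(n i)) k | k : 'I_(n c)].
  apply/setP => -[i k]; rewrite inE /=.
  apply/eqP/imsetP => [ic|[k' _ /(congr1 tag)] //].
  by subst i; exists k.
rewrite card_imset ?card_ord // => k k' /eqP.
by rewrite -tag_eqE /tag_eq /= eqxx tagged_asE => /eqP.
Qed.

Lemma card_preim_bij (aT rT : finType) (f : aT -> rT) (P : pred rT) :
  bijective f -> #|[set i | P (f i)]| = #|[set x | P x]|.
Proof.
move=> f_bij; rewrite -(on_card_preimset (onW_bij [set x | P x] f_bij)).
by apply: eq_card => i; rewrite !inE.
Qed.

Lemma prod_block_factor_neq0 (R : idomainType) (b : nat) (n : 'I_b -> nat) :
  \prod_i ('X + 3%:R * (n i)%:R + 1) != 0 :> {poly R}.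
Proof.
apply/prodf_neq0 => i _.
have := polyXsubC_eq0 (- (3%:R * (n i)%:R + 1) : R).
by rewrite polyCN opprK polyCD polyCM !polyC_natr polyC1 addrA => ->.
Qed.

Lemma expr_Xadd1_neq0 (R : idomainType) (k : nat) : ('X + 1) ^+ k != 0 :> {poly R}.
Proof. by rewrite expf_neq0 // -[1](opprK 1) -polyC1 -polyCN polyXsubC_eq0. Qed.

Lemma mulf_exprI_leq (R : idomainType) k m (y A B : R) :
  (k <= m)%N -> y ^+ k != 0 -> y ^+ k * A = y ^+ m * B -> A = y ^+ (m - k) * B.
Proof. by move=> km y0; rewrite -{1}(subnKC km) exprD -mulrA => /(mulfI y0). Qed.

(** Here the classes are the blocks, with [n i] vertices each. *)
Lemma char_poly_slb_off_center (R : idomainType) (b : nat) (n : 'I_b -> nat)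
    m (w : 'I_m -> {i : 'I_b & 'I_(n i)}) :
    (b <= m)%N -> bijective w ->
  char_poly (\matrix_(i, j)
     (gdist (@slb_adj b n) (Some (w i)) (Some (w j)) ^ 2)%:R : 'M[R]_m) =
  ('X + 1) ^+ (m - b)%N *
    (\prod_(i < b) ('X + 3%:R * (n i)%:R + 1)
     - 4%:R * \sum_(i < b) (n i)%:R *
         \prod_(j < b | j != i) ('X + 3%:R * (n j)%:R + 1)).
Proof.
move=> bm w_bij.
rewrite char_poly_slb_vertices; last by move=> i j [] /(bij_inj w_bij).
apply: mulf_exprI_leq => //; first exact: expr_Xadd1_neq0.
pose K : 'M[{poly R}]_b := \matrix_(c, d) (if c != d then - 4%:R else - 1).
have -> : (\matrix_(i, j) (if split_blocks (Some (w i)) (Some (w j))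
             then - 4%:R else - 1) : 'M[{poly R}]_m) =
          \matrix_(i, j) K (tag (w i)) (tag (w j)).
  by apply/matrixP => i j; rewrite !mxE.
rewrite (det_scalar_add_const_blocks _ (fun i => tag (w i))); congr (_ * _).
have -> : ('X + 1)%:M + K *m diag_mx (\row_c #|[set i | tag (w i) == c]|%:R) =
          diag_mx (\row_c ('X + 3%:R * (n c)%:R + 1)) +
          const_mx (- 4%:R) *m \row_c (n c)%:R.
  apply/matrixP => c d; rewrite mul_mx_diag !mxE big_ord1 !mxE.
  rewrite (card_preim_bij (fun x => tag x == d) w_bij) card_tag_fibre.
  by case: eqP => [->|_] /=; rewrite ?mulr1n ?mulr0n; ring.
have Pn0 := prod_block_factor_neq0 R n.
rewrite (@det_diag_add_rank1 {poly R}); last by under eq_bigr do rewrite mxE.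
under eq_bigr do rewrite mxE.
congr (_ + _); rewrite mulr_sumr -sumrN; apply: eq_bigr => i _.
rewrite !mxE; under eq_bigr do rewrite mxE.
ring.
Qed.

(** The central vertex is separated from no other vertex, unlike the members of
    any block, so it forms a class of size one of its own, placed before the
    [b] classes of the blocks. *)
Lemma char_poly_slb_all_vertices (R : idomainType) (b : nat) (n : 'I_b -> nat)
    m (f : 'I_m -> slb_vertex n) :
    (b < m)%N -> bijective f ->
  char_poly (\matrix_(i, j) (gdist (@slb_adj b n) (f i) (f j) ^ 2)%:R : 'M[R]_m) =
  ('X + 1) ^+ (m - b.+1)%N *
    ('X * \prod_(i < b) ('X + 3%:R * (n i)%:R + 1)
     - (4%:R * 'X + 1) *
       \sum_(i < b) (n i)%:R *
         \prod_(j < b | j != i) ('X + 3%:R * (n j)%:R + 1)).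
Proof.
move=> bm f_bij.
rewrite char_poly_slb_vertices; last exact: bij_inj.
apply: mulf_exprI_leq => //; first exact: expr_Xadd1_neq0.
pose t (v : slb_vertex n) : 'I_(1 + b) :=
  if v is Some x then rshift 1 (tag x) else lshift b ord0.
pose A : 'M[{poly R}]_b := \matrix_(c, d) (if c != d then - 4%:R else - 1).
pose K := block_mx (- 1%:M : 'M_1) (- const_mx 1) (- const_mx 1) A.
have -> : (\matrix_(i, j) (if split_blocks (f i) (f j) then - 4%:R else - 1)
             : 'M[{poly R}]_m) = \matrix_(i, j) K (t (f i)) (t (f j)).
  apply/matrixP => i j; rewrite [LHS]mxE [RHS]mxE /K.
  by case: (f i) (f j) => [x|] [x'|] /=;
    rewrite ?block_mxEul ?block_mxEur ?block_mxEdl ?block_mxEdr !mxE.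
apply: etrans (@det_scalar_add_const_blocks _ _ (1 + b) _ (fun i => t (f i)) K) _.
congr (_ * _).
pose N := row_mx (const_mx 1 : 'rV[{poly R}]_1) (\row_c (n c)%:R).
have -> : \row_c #|[set i | t (f i) == c]|%:R = N.
  apply/rowP => c; rewrite mxE (card_preim_bij (fun v => t v == c) f_bij) /N.
  rewrite -(splitK c); case: split => c' /=.
    rewrite row_mxEl mxE !ord1 -[RHS]/(1%:R); congr (_%:R).
    rewrite -[RHS](cards1 (None : slb_vertex n)); apply: eq_card => -[x|];
      by rewrite !inE /= ?eq_rlshift ?eqxx.
  rewrite row_mxEr mxE -card_tag_fibre -(card_imset _ (@Some_inj _)).
  congr (_%:R); apply: eq_card => -[x|]; rewrite !inE.
    by rewrite eq_rshift mem_imset ?inE //; apply: Some_inj.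
  by rewrite /= eq_lrshift; apply/esym/imsetP => -[].
(* The column weight 4 is the row operation coefficient that absorbs the
   entries 4 between different blocks. *)
have -> : ('X + 1)%:M + K *m diag_mx N =
          block_mx 'X%:M (- \row_c (n c)%:R)
            (const_mx (- (4%:R * 'X + 1)) + 'X *: const_mx 4%:R)
            (diag_mx (\row_c ('X + 3%:R * (n c)%:R + 1)) +
             const_mx 4%:R *m - \row_c (n c)%:R).
  rewrite diag_mx_row /K mulmx_block scalar_mx_block add_block_mx.
  rewrite !mulmx0 !addr0 !add0r.
  congr block_mx; apply/matrixP => c d; rewrite ?mul_mx_diag !mxE ?big_ord1 ?mxE.
  - by rewrite !ord1 /=; ring.
  - ring.
  - ring.
  by case: eqP => [->|_] /=; rewrite ?mulr1n ?mulr0n; ring.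
have Pn0 := prod_block_factor_neq0 R n.
rewrite (@det_arrowhead_row_op {poly R}); last by under eq_bigr do rewrite mxE.
under eq_bigr do rewrite mxE.
congr (_ - _); rewrite mulr_sumr; apply: eq_bigr => i _.
rewrite !mxE; under eq_bigr do rewrite mxE.
ring.
Qed.

(** * The characteristic polynomials *)

Theorem theorem2p4 (R : realFieldType) (b : nat) (n : 'I_b -> nat)
    (hb : (2 <= b)%N) (hn : forall i : 'I_b, (0 < n i)%N) :
  char_poly (slb_Delta R n) =
    ('X + 1) ^+ ((\sum_(i < b) n i) - b)%N *
    ('X * \prod_(i < b) ('X + 3%:R * (n i)%:R + 1)
     - (4%:R * 'X + 1) *
       \sum_(i < b) (n i)%:R *
         \prod_(j < b | j != i) ('X + 3%:R * (n j)%:R + 1))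
  /\
  char_poly (slb_Delta22 R n) =
    ('X + 1) ^+ ((\sum_(i < b) n i) - b)%N *
    (\prod_(i < b) ('X + 3%:R * (n i)%:R + 1)
     - 4%:R *
       \sum_(i < b) (n i)%:R *
         \prod_(j < b | j != i) ('X + 3%:R * (n j)%:R + 1)).
Proof.
have cardV : #|slb_vertex n| = (\sum_(i < b) n i).+1 by rewrite card_slb_vertex.
have bN : (b <= \sum_(i < b) n i)%N.
  by rewrite -{1}[b]card_ord -sum1_card; apply: leq_sum.
split.
  rewrite char_poly_slb_all_vertices; [|by rewrite cardV|exact: enum_val_bij].
  by rewrite cardV subSS.
set c := enum_rank (slb_center n).
have [w wE] : exists w : 'I_#|slb_vertex n|.-1 -> {i : 'I_b & 'I_(n i)},
    forall i, enum_val (lift c i) = Some (w i).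
  apply: (fin_all_exists (P := fun i x => enum_val (lift c i) = Some x)) => i.
  case E: (enum_val (lift c i)) => [x|]; first by exists x.
  by case/eqP: (neq_lift c i); rewrite -[RHS]enum_valK E.
have w_bij : bijective w.
  apply: inj_card_bij => [i j wij|].
    by apply: (@lift_inj _ c); apply: enum_val_inj; rewrite !wE wij.
  by rewrite card_ord card_option.
have -> : slb_Delta22 R n = \matrix_(i, j)
    (gdist (@slb_adj b n) (Some (w i)) (Some (w j)) ^ 2)%:R.
  by apply/matrixP => i j; rewrite !mxE -!wE.
by rewrite char_poly_slb_off_center //; rewrite cardV.
Qed.
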